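(* Let $R=\mathbb{K}[x_1,\ldots,x_d]$ be a polynomial ring over a field $\mathbb{K}$, and let $G=\langle g_1,\ldots,g_a\rangle$ be a finite group, with $a\leq d$, which acts linearly on $R$ in such a way that, for all $1\le i\le a$ and $1\le j\le d$, $$g_i(x_j)=\begin{cases} x_j & \text{if } j\neq i,\\ \omega_i x_j & \text{if } j=i,\end{cases}$$ where $\omega_i\in\mathbb{K}$ is a $d_i$-th root of unity (that is, $\omega_i^{d_i}=1$) with $d_i\geq 1$. Let $I_G=\bigcap_{g\in G}(y_1-g(x_1),\ldots,y_d-g(x_d))\subseteq S=\mathbb{K}[x_1,\ldots,x_d,y_1,\ldots,y_d]$ be the Derksen ideal. Then $I_G^{(n)}=I_G^n$ for every $n\geq 1$.
   Context: A group $G$ acts linearly on $R=\mathbb{K}[x_1,\ldots,x_d]$ if it acts by ring automorphisms such that $g(a)=a$ for every $a\in\mathbb{K}$, $g\in G$, and $g(x_i)$ is a homogeneous linear polynomial (degree-one form) for every $i=1,\ldots,d$ and $g\in G$. Symbolic powers: for an ideal $I\subseteq S$, the $n$-th symbolic power is $I^{(n)}=\bigcap_{\mathfrak{p}\in\mathrm{Ass}(S/I)}(I^nS_{\mathfrak{p}}\cap S)$, where $\mathrm{Ass}(S/I)$ is the set of associated primes of $I$ and $I^nS_{\mathfrak{p}}\cap S$ denotes the preimage of $I^nS_{\mathfrak{p}}$ under $S\to S_{\mathfrak{p}}$. *)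

(* Defs.v *)
From HB Require Import structures.
From mathcomp Require Import all_boot all_fingroup all_algebra fraction.
From mathcomp Require Import boolp classical_sets.
From mathcomp Require Import mpoly.

Set Implicit Arguments.
Unset Strict Implicit.
Unset Printing Implicit Defensive.

Import GRing.Theory.

Local Open Scope classical_set_scope.
Local Open Scope ring_scope.

Section Ideals.
Variable S : comNzRingType.

Definition lin_span (C A : set S) : set S :=
  [set x | exists (n : nat) (c a : 'I_n -> S),
     [/\ forall k, C (c k), forall k, A (a k) & x = \sum_k c k * a k]].

Definition ideal_gen (A : set S) : set S := lin_span setT A.

Definition ideal_pow (I : set S) (n : nat) : set S :=
  ideal_gen [set x | exists a : 'I_n -> S,
                       (forall k, I (a k)) /\ x = \prod_k a k].

Definition is_ideal (I : set S) : Prop :=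
  [/\ I 0, forall x y, I x -> I y -> I (x + y)
    & forall r x, I x -> I (r * x)].

Definition prime_ideal (p : set S) : Prop :=
  [/\ is_ideal p, ~ p 1 & forall x y, p (x * y) -> p x \/ p y].

(* p is in Ass(S/I) when it is a prime of the form ann_S(f + I). *)
Definition associated_prime (I p : set S) : Prop :=
  prime_ideal p /\ exists f : S, p = [set s | I (s * f)].

End Ideals.

Section SymbolicPower.
Variable S : idomainType.

(* As S is a domain, S_p is realised inside the field of fractions of S, the
   map S -> S_p being the inclusion tofrac. *)
Definition localization (p : set S) : set {fraction S} :=
  [set u | exists b s : S, ~ p s /\ u = tofrac b / tofrac s].

(* J S_p, the ideal of S_p generated by the image of J. *)
Definition extension (J p : set S) : set {fraction S} :=
  lin_span (localization p) (@tofrac S @` J).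

Definition symbolic_power (I : set S) (n : nat) : set S :=
  \bigcap_(p in associated_prime I)
     (@tofrac S @^-1` extension (ideal_pow I n) p).

End SymbolicPower.

Section LinearAction.
Variables (K : fieldType) (d : nat) (G : finGroupType).

(* A left action, by ring endomorphisms; the first two laws make each act g
   bijective, hence an automorphism. *)
Record linear_action
    (act : G -> {rmorphism {mpoly K[d]} -> {mpoly K[d]}}) : Prop := {
  linear_action1 : forall f, act 1%g f = f;
  linear_actionM : forall g h f, act (g * h)%g f = act g (act h f);
  linear_actionC : forall g (c : K), act g c%:MP = c%:MP;
  linear_actionX : forall g (i : 'I_d), act g 'X_i \is 1.-homog
}.

(* S = K[x_1,...,x_d,y_1,...,y_d] is {mpoly K[d + d]}, the x's being the first
   d variables and the y's the last d ones. *)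
Definition xvar (i : 'I_d) : {mpoly K[d + d]} := 'X_(lshift d i).
Definition yvar (i : 'I_d) : {mpoly K[d + d]} := 'X_(rshift d i).

Definition in_xvars (f : {mpoly K[d]}) : {mpoly K[d + d]} :=
  f \mPo [tuple xvar i | i < d].

Definition derksen_ideal
    (act : G -> {rmorphism {mpoly K[d]} -> {mpoly K[d]}}) :
    set {mpoly K[d + d]} :=
  \bigcap_(g in [set: G])
     ideal_gen (range (fun i : 'I_d => yvar i - in_xvars (act g 'X_i))).

End LinearAction.

(* Main.v *)
(** Let W_i be the finite set of scalars by which G acts on x_i. Since the g_i
    act on separate variables, every c in the product of the W_i comes from an
    element of G, so I_G is the ideal of the union of the subspaces y = c x,
    and it is generated by the products f_i of the y_i - b x_i, b in W_i. In
    the local coordinates z_i = y_i - c_i x_i along the component y = c x, each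
    f_i is z_i times a factor that does not vanish on the component. Hence if h
    is a form of degree m in the f_i and s h lies in I_G^(m+1) with s nonzero on
    the component, then comparing the coefficients of degree m in z shows that
    the coefficients of the form vanish on the component. If h is in the n-th
    symbolic power and m < n, this holds for all components, so the coefficients
    lie in I_G and h lies in I_G^(m+1); the result follows by induction on m. *)
Require Import Defs.
From HB Require Import structures.
From mathcomp Require Import all_boot all_fingroup all_algebra fraction.
From mathcomp Require Import boolp classical_sets.
From mathcomp Require Import mpoly.

Set Implicit Arguments.
Unset Strict Implicit.
Unset Printing Implicit Defensive.

Import GRing.Theory.

Local Open Scope ring_scope.

(** * Generated ideals, their powers, and forms in the generators *)

Section Ideals.
Variable S : comNzRingType.
Implicit Types (I J A : set S) (x y : S).

Lemma ideal_sum J (T : Type) (r : seq T) (P : pred T) (F : T -> S) :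
  is_ideal J -> (forall i, P i -> J (F i)) -> J (\sum_(i <- r | P i) F i).
Proof. by case=> J0 JD _ JF; apply: big_ind. Qed.

Lemma ideal_subM J x y x1 y1 : is_ideal J ->
  J (x - x1) -> J (y - y1) -> J (x * y - x1 * y1).
Proof.
case=> _ JD JM Jx Jy.
have -> : x * y - x1 * y1 = y * (x - x1) + x1 * (y - y1).
  by rewrite !mulrBr [y * x]mulrC [y * x1]mulrC addrA subrK.
by apply: JD; apply: JM.
Qed.

Lemma ideal_gen_is_ideal A : is_ideal (ideal_gen A).
Proof.
split.
- exists 0%N, (fun _ => 0), (fun _ => 0).
  by split=> [k|[]|]//; rewrite big_ord0.
- move=> x y [n [c [a [_ Aa ->]]]] [m [c' [a' [_ Aa' ->]]]].
  pose join (u : 'I_n -> S) (v : 'I_m -> S) k :=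
    match fintype.split k with inl i => u i | inr i => v i end.
  exists (n + m)%N, (join c c'), (join a a'); split=> // [k|].
    by rewrite /join; case: (fintype.split k).
  rewrite big_split_ord /=; congr (_ + _); apply: eq_bigr => k _.
    by rewrite /join (unsplitK (inl k)).
  by rewrite /join (unsplitK (inr k)).
- move=> r x [n [c [a [_ Aa ->]]]]; exists n, (fun k => r * c k), a.
  by split=> //; rewrite mulr_sumr; apply: eq_bigr => k _; rewrite mulrA.
Qed.

Lemma mem_ideal_gen A x : A x -> ideal_gen A x.
Proof.
move=> Ax; exists 1%N, (fun _ => 1), (fun _ => x).
by split=> //; rewrite big_ord1 mul1r.
Qed.

(** Serves as the induction principle for [ideal_gen]: a property holds on all of it once the
    elements having it form an ideal containing [A]. *)
Lemma ideal_gen_min A J : is_ideal J -> (A `<=` J)%classic ->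
  (ideal_gen A `<=` J)%classic.
Proof.
move=> idJ AJ x [n [c [a [_ Aa ->]]]]; apply: ideal_sum => // k _.
by case: idJ => _ _; apply; apply: AJ.
Qed.

Lemma ideal_gen_rangeP d (f : 'I_d -> S) x : ideal_gen (range f) x <->
  exists q : 'I_d -> S, x = \sum_i q i * f i.
Proof.
split=> [|[q ->]]; last first.
  apply: ideal_sum; first exact: ideal_gen_is_ideal.
  move=> i _; have [_ _] := ideal_gen_is_ideal (range f); apply.
  by apply: mem_ideal_gen; exists i.
apply: (@ideal_gen_min _ [set x | exists q : 'I_d -> S, x = \sum_i q i * f i]).
  split=> /= [|y z [q ->] [r ->]|r y [q ->]].
  - by exists (fun _ => 0); rewrite big1 // => i _; rewrite mul0r.
  - exists (fun i => q i + r i); rewrite -big_split /=.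
    by apply: eq_bigr => i _; rewrite mulrDl.
  - exists (fun i => r * q i); rewrite mulr_sumr.
    by apply: eq_bigr => i _; rewrite mulrA.
move=> _ [i _ <-]; exists (fun j => (j == i)%:R).
by rewrite (bigD1 i) //= eqxx mul1r big1 ?addr0 // => j /negPf->; rewrite mul0r.
Qed.

Lemma ideal_pow_prod I n (a : 'I_n -> S) :
  (forall k, I (a k)) -> ideal_pow I n (\prod_k a k).
Proof. by move=> Ia; apply: mem_ideal_gen; exists a. Qed.

Lemma ideal_pow0 I : ideal_pow I 0 1.
Proof.
have := @ideal_pow_prod I 0 (fun _ => 0); rewrite big_ord0; apply.
by case.
Qed.

Lemma ideal_pow1 I x : I x -> ideal_pow I 1 x.
Proof.
by move=> Ix; have := @ideal_pow_prod I 1 (fun _ => x) (fun _ => Ix);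
  rewrite big_ord1.
Qed.

(** Each factor in turn is reduced to a generator by [ideal_gen_min], and two products of [m] and
    [n] elements of [I] are then concatenated. *)
Lemma ideal_powM I m n x y :
  ideal_pow I m x -> ideal_pow I n y -> ideal_pow I (m + n) (x * y).
Proof.
have [P0 PD PM] := ideal_gen_is_ideal
  [set x | exists a : 'I_(m + n) -> S, (forall k, I (a k)) /\ x = \prod_k a k].
rewrite -/(ideal_pow I (m + n)) in P0 PD PM.
move=> Ix Iy; move: x Ix.
apply: (@ideal_gen_min _ [set x | ideal_pow I (m + n) (x * y)]).
  split=> /= [|u v Iu Iv|r u Iu]; first by rewrite mul0r.
  - by rewrite mulrDl; apply: PD.
  - by rewrite -mulrA; apply: PM.
move=> _ [a [Ia ->]] /=; move: y Iy.
apply: (@ideal_gen_min _ [set y | ideal_pow I (m + n) (\prod_k a k * y)]).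
  split=> /= [|u v Iu Iv|r u Iu]; first by rewrite mulr0.
  - by rewrite mulrDr; apply: PD.
  - by rewrite mulrCA; apply: PM.
move=> _ [b [Ib ->]] /=.
pose ab k := match fintype.split k with inl i => a i | inr i => b i end.
have := @ideal_pow_prod I (m + n) ab.
rewrite big_split_ord /=.
under eq_bigr do rewrite /ab (unsplitK (inl _)).
under [X in _ * X]eq_bigr do rewrite /ab (unsplitK (inr _)).
by apply=> k; rewrite /ab; case: (fintype.split k).
Qed.

Lemma ideal_powX I n x : I x -> ideal_pow I n (x ^+ n).
Proof.
move=> Ix; elim: n => [|n IHn]; first exact: ideal_pow0.
by rewrite exprS -add1n; apply: ideal_powM => //; apply: ideal_pow1.
Qed.

Lemma ideal_pow_bigprod I (T : finType) (e : T -> nat) (x : T -> S) :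
  (forall i, ideal_pow I (e i) (x i)) ->
  ideal_pow I (\sum_i e i)%N (\prod_i x i).
Proof.
move=> Ix; apply: (big_ind2 (fun x n => ideal_pow I n x)) => //.
- exact: ideal_pow0.
- by move=> *; apply: ideal_powM.
Qed.

(** The coefficient of each monomial contributes one factor from [I] and the monomial itself [m]
    more, hence the exponent [m.+1]. *)
Lemma ideal_pow_meval d (f : 'I_d -> S) I m (q : {mpoly S[d]}) :
  (forall i, I (f i)) -> (forall k, I q@_k) -> q \is m.-homog ->
  ideal_pow I m.+1 q.@[f].
Proof.
move=> If Iq /dhomogP hq; rewrite mevalE big_seq.
apply: ideal_sum; first exact: ideal_gen_is_ideal.
move=> k /hq /= <-; rewrite -add1n; apply: ideal_powM; first exact: ideal_pow1.
by rewrite mdegE; apply: ideal_pow_bigprod => i; apply: ideal_powX.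
Qed.

(** A product of [m] elements of the ideal is a product of [m] linear forms evaluated at [f]. The
    form [q] is in general not unique. *)
Lemma ideal_pow_homog d (f : 'I_d -> S) m x :
  ideal_pow (ideal_gen (range f)) m x ->
  exists2 q : {mpoly S[d]}, q \is m.-homog & x = q.@[f].
Proof.
move: x; apply: (@ideal_gen_min _
  [set x | exists2 q : {mpoly S[d]}, q \is m.-homog & x = q.@[f]]).
  split=> /= [|_ _ [p hp ->] [q hq ->]|r _ [q hq ->]].
  - by exists 0; [exact: dhomog0 | rewrite meval0].
  - by exists (p + q); [exact: dhomogD | rewrite mevalD].
  - by exists (r *: q); [exact: dhomogZ | rewrite mevalZ].
move=> _ [a [+ ->]] /=; elim: m a => [|m IHm] a Ia.
  by exists 1; [exact: dhomog1 | rewrite big_ord0 meval1].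
have [q hq def_q] := IHm _ (fun k => Ia (lift ord0 k)).
have [r def_r] := (ideal_gen_rangeP _ _).1 (Ia ord0).
exists ((\sum_i r i *: 'X_i) * q).
  rewrite -add1n; apply: dhomogM => //; apply: rpred_sum => i _.
  by apply: dhomogZ; rewrite dhomogX /= mdeg1.
rewrite big_ord_recl def_q def_r mevalM; congr (_ * _).
by rewrite raddf_sum /=; apply: eq_bigr => i _; rewrite mevalZ mevalXU.
Qed.

End Ideals.

(** * Symbolic powers without fractions, and a criterion for equality with powers *)

Section SymbolicPowers.
Variable S : idomainType.
Implicit Types I J p : set S.

(** A finite combination of fractions has a common denominator, which stays outside [p] by
    primality; conversely [h] is [1 / s] times [s * h]. *)
Lemma extensionP J p h : is_ideal J -> prime_ideal p ->
  extension J p (tofrac h) <-> exists2 s, ~ p s & J (s * h).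
Proof.
move=> idJ [[p0 _ _] p1 pM]; split=> [[n [c [a [locc Ja def_h]]]]|].
  have nz s : ~ p s -> tofrac s != 0 :> {fraction S}.
    by rewrite tofrac_eq0 => ps; apply/eqP => s0; apply: ps; rewrite s0.
  have [J0 JD JM] := idJ.
  have [s ps [b Jb]] : exists2 s, ~ p s &
      exists2 b, J b & tofrac s * tofrac h = tofrac b :> {fraction S}.
    rewrite def_h; apply: (big_ind (fun u => exists2 s, ~ p s &
      exists2 b, J b & tofrac s * u = tofrac b :> {fraction S})).
    - by exists 1 => //; exists 0; rewrite ?mulr0 ?tofrac0.
    - move=> u v [s ps [b Jb eqb]] [t pt [b' Jb' eqb']].
      exists (s * t); first by case/pM.
      exists (t * b + s * b'); first by apply: JD; apply: JM.
      by rewrite tofracD !tofracM -eqb -eqb' mulrDr [_ s * _ t]mulrC -!mulrA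
        [X in _ + X]mulrCA.
    - move=> k _; have [b [s [ps ->]]] := locc k; have [j Jj <-] := Ja k.
      exists s => //; exists (b * j); first exact: JM.
      by rewrite mulrA mulrCA divff ?nz // mulr1 tofracM.
  rewrite -tofracM => /eqP; rewrite tofrac_eq => /eqP eqb.
  by exists s; rewrite ?eqb.
case=> s ps Jsh; exists 1%N, (fun _ => tofrac 1 / tofrac s).
exists (fun _ => tofrac (s * h)); split=> [_|_|].
- by exists 1, s.
- by exists (s * h).
- rewrite big_ord1 tofrac1 mul1r tofracM mulKf // tofrac_eq0.
  by apply/eqP => s0; apply: ps; rewrite s0.
Qed.

(* The hypothesis on [q] is a localised form of quasi-regularity of [f]: modulo
   [I], the forms of degree [m] in [f] satisfy no nontrivial relation. *)
Lemma symbolic_power_quasi_regular d (f : 'I_d -> S) (T : Type)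
    (p : T -> set S) I n :
  I = ideal_gen (range f) ->
  (forall t, associated_prime I (p t)) ->
  (forall h, (forall t, p t h) -> I h) ->
  (forall t m (q : {mpoly S[d]}) s, q \is m.-homog -> ~ p t s ->
     ideal_pow I m.+1 (s * q.@[f]) -> forall k, p t q@_k) ->
  symbolic_power I n = ideal_pow I n.
Proof.
move=> defI assp capp qreg; have idpow j := ideal_gen_is_ideal
  [set x | exists a : 'I_j -> S, (forall k, I (a k)) /\ x = \prod_k a k].
apply/seteqP; split=> h; last first.
  move=> Ih q [primeq _] /=; apply/extensionP=> //; first exact: idpow.
  by exists 1; [case: primeq | rewrite mul1r].
move=> symh.
have witness t : exists2 s, ~ p t s & ideal_pow I n (s * h).
  by apply/extensionP; [exact: idpow | exact: (assp t).1 | exact: symh].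
have powS m x : ideal_pow I m.+1 x -> ideal_pow I m x.
  apply: ideal_gen_min; first exact: idpow.
  move=> _ [a [Ia ->]]; rewrite big_ord_recl.
  by have [_ _] := idpow m; apply; apply: ideal_pow_prod.
have pow_le m x : (m <= n)%N -> ideal_pow I n x -> ideal_pow I m x.
  by move=> /subnK <-; elim: (n - m)%N => // j IHj; rewrite addSn => /powS.
suff: forall m, (m <= n)%N -> ideal_pow I m h by apply.
elim=> [_|m IHm lt_mn].
  (* The zeroth power contains 1, so it is the whole ring. *)
  by have [_ _ powM] := idpow 0%N; rewrite -[h]mulr1; apply: powM; apply: ideal_pow0.
have [|q hq def_h] := @ideal_pow_homog _ _ f m h.
  by rewrite -defI; apply: IHm; apply: ltnW.
rewrite def_h; apply: ideal_pow_meval => // [i|k].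
  by rewrite defI; apply: mem_ideal_gen; exists i.
(* The multiplier [s] may depend on [t]: each prime is treated separately and [capp] reassembles the
   conclusions. Since [m < n], the [n]-th power lies in the power [m.+1] that [qreg] asks for. *)
apply: capp => t; have [s ps Ish] := witness t.
by apply: (qreg t m q s) => //; rewrite -def_h; apply: pow_le.
Qed.

End SymbolicPowers.

(** * Order of vanishing at the origin and comparison of leading coefficients *)

Section Orders.
Variables (R : idomainType) (d : nat).
Implicit Types (p q : {mpoly R[d]}).

(** Equivalently, [p] lies in the [n]-th power of the ideal generated by the variables. *)
Definition order_ge n p := forall k, (mdeg k < n)%N -> p@_k = 0.

Lemma order_geM m n p q :
  order_ge m p -> order_ge n q -> order_ge (m + n) (p * q).
Proof.
move=> op oq k lt_k; rewrite mcoeffM big1 // => -[k1 k2] /= /eqP def_k.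
have lt12 : (mdeg k1 + mdeg k2 < m + n)%N by rewrite -mdegD -def_k.
have [lt1|le1] := ltnP (mdeg k1) m; first by rewrite op ?mul0r.
rewrite oq ?mulr0 // -(ltn_add2l m); apply: leq_ltn_trans lt12.
by rewrite leq_add2r.
Qed.

Lemma order_ge_ideal (S : comNzRingType) (phi : {rmorphism S -> {mpoly R[d]}}) n :
  is_ideal [set x | order_ge n (phi x)].
Proof.
split=> /= [k _|x y ox oy k lt_k|r x ox].
- by rewrite rmorph0 mcoeff0.
- by rewrite rmorphD mcoeffD ox ?oy ?addr0.
- by rewrite rmorphM -[n]add0n; apply: order_geM.
Qed.

(** A vanishing constant term means order at least 1, and orders add up in products. *)
Lemma order_ge_pow (S : comNzRingType) (phi : {rmorphism S -> {mpoly R[d]}})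
    (I : set S) n x :
  (forall y, I y -> (phi y)@_0%MM = 0) ->
  ideal_pow I n x -> order_ge n (phi x).
Proof.
move=> I0; move: x; apply: (@ideal_gen_min _ _ [set x | order_ge n (phi x)]).
  exact: order_ge_ideal.
move=> _ [a [Ia ->]] /=; rewrite rmorph_prod /=.
elim: n a Ia => [|n IHn] a Ia; first by move=> k; rewrite ltn0.
rewrite big_ord_recl; apply: (@order_geM 1 n); last by apply: IHn.
by move=> k; rewrite ltnS leqn0 mdeg_eq0 => /eqP->; apply: I0.
Qed.

(** Every other term of [p] raises the degree above [mdeg m], so only the constant term is seen. *)
Lemma mcoeff_mulX_mdeg p m k : mdeg k = mdeg m ->
  (p * 'X_[m])@_k = p@_0%MM *+ (k == m).
Proof.
move=> eq_km; case: eqVneq => [->|neq_km].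
  by have := mcoeffMX p m 0%MM; rewrite addm0 mulr1n.
rewrite mcoeffM big1 ?mulr0n // => -[k1 k2] /= /eqP def_k.
rewrite mcoeffX; case: eqP => [eq2|_]; last by rewrite mulr0.
have : (mdeg k1 + mdeg m)%N = mdeg m by rewrite [in LHS]eq2 -mdegD -def_k.
move/eqP; rewrite -[X in _ == X]add0n eqn_add2r mdeg_eq0 => /eqP k10.
by case/negP: neq_km; apply/eqP; rewrite [LHS]def_k k10 add0m eq2.
Qed.

(** The coefficient at [k] of the image of [s * q.@[f]] is a product of the constant terms of
    [phi s], of [phi q@_k] and of powers of the [u i]. It vanishes by the order hypothesis, and in a
    domain the only factor that can be zero is the middle one. *)
Lemma mcoeff_form (S : comNzRingType) (phi : {rmorphism S -> {mpoly R[d]}})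
    (f : 'I_d -> S) (u : 'I_d -> {mpoly R[d]}) m (q : {mpoly S[d]}) s k :
  (forall i, phi (f i) = u i * 'X_i) -> (forall i, (u i)@_0%MM != 0) ->
  q \is m.-homog -> (phi s)@_0%MM != 0 -> order_ge m.+1 (phi (s * q.@[f])) ->
  (phi q@_k)@_0%MM = 0.
Proof.
move=> phif u0 hq s0 osq.
have [k_q|/memN_msupp_eq0->] := boolP (k \in msupp q); last first.
  by rewrite rmorph0 mcoeff0.
have degq j : j \in msupp q -> mdeg j = m by move: j; apply/dhomogP.
have := osq k; rewrite degq // => /(_ (ltnSn m)).
rewrite mevalE mulr_sumr rmorph_sum raddf_sum /= (bigD1_seq k) ?msupp_uniq //=.
have term j : phi (s * (q@_j * \prod_i f i ^+ j i)) =
    phi s * phi q@_j * (\prod_i u i ^+ j i) * 'X_[j].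
  rewrite !rmorphM rmorph_prod -!mulrA; congr (_ * (_ * _)).
  rewrite mpolyXE_id -big_split /=; apply: eq_bigr => i _.
  by rewrite rmorphXn phif exprMn.
have uk : (\prod_i u i ^+ k i)@_0%MM != 0.
  rewrite rmorph_prod; apply/prodf_neq0 => i _ /=.
  by rewrite rmorphXn; apply: expf_neq0; apply: u0.
(* The other monomials of [q] have the same degree as [k], so none of them reaches the coefficient
   at [k]. *)
rewrite [X in _ + X]big_seq_cond [X in _ + X]big1 => [|j /andP[j_q neq_jk]]; last first.
  rewrite term mcoeff_mulX_mdeg ?degq //.
  by rewrite eq_sym (negPf neq_jk).
rewrite addr0 term mcoeff_mulX_mdeg // eqxx mulr1n !rmorphM /=.
by move/eqP; rewrite !mulf_eq0 (negPf s0) (negPf uk) orbF /= => /eqP.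
Qed.

End Orders.

(** * Expansion along the subspaces y = c x, and the ideal of a grid of them *)

Section Points.
Variables (K : fieldType) (d : nat).
Implicit Types (c : 'I_d -> K) (r : 'I_d -> seq K) (h : {mpoly K[d + d]}).

Definition taylor_var c (v : 'I_(d + d)) : {mpoly {mpoly K[d]}[d]} :=
  match fintype.split v with
  | inl i => ('X_i)%:MP
  | inr i => 'X_i + (c i *: 'X_i)%:MP
  end.

(* Expansion along the subspace y = c x: the outer variables stand for the
   y_i - c_i x_i. *)
Definition taylor c : {mpoly K[d + d]} -> {mpoly {mpoly K[d]}[d]} :=
  mmap (@mpolyC d {mpoly K[d]} \o @mpolyC d K) (taylor_var c).

HB.instance Definition _ c := GRing.RMorphism.on (taylor c).

(** The constant term of the expansion is obtained by substituting [c i *: 'X_i] for y_i: this is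
    restriction to the subspace y = c x, parametrised by x. *)
Definition restr c : {mpoly K[d + d]} -> {mpoly K[d]} := mcoeff 0%MM \o taylor c.

HB.instance Definition _ c := GRing.RMorphism.on (restr c).

Lemma taylorC c a : taylor c a%:MP = a%:MP%:MP.
Proof. by rewrite /taylor mmapC. Qed.

Lemma taylorX c v : taylor c 'X_v = taylor_var c v.
Proof. by rewrite /taylor mmapX mmap1U. Qed.

Lemma restrC c a : restr c a%:MP = a%:MP.
Proof. by rewrite /restr /= taylorC mcoeffC eqxx mulr1. Qed.

Definition line (i : 'I_d) (b : K) := yvar K i - b *: xvar K i.

Lemma taylor_line c i b : taylor c (line i b) = 'X_i + ((c i - b) *: 'X_i)%:MP.
Proof.
rewrite rmorphB -mul_mpolyC rmorphM /= taylorC !taylorX /taylor_var.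
rewrite (unsplitK (inl i)) (unsplitK (inr i)) -addrA; congr (_ + _).
by rewrite -!mpolyCM -mpolyCB -!mul_mpolyC -mulrBl -mpolyCB.
Qed.

Lemma restr_line c i b : restr c (line i b) = (c i - b) *: 'X_i.
Proof.
rewrite /restr /= taylor_line mcoeffD mcoeffC eqxx mulr1 mcoeffX.
by rewrite mnm1_eq0 add0r.
Qed.

Lemma restr_line_eq0 c i b : (restr c (line i b) == 0) = (b == c i).
Proof.
rewrite restr_line -mul_mpolyC mulf_eq0 mpolyC_eq0 subr_eq0 eq_sym.
case: eqP => // _; apply/eqP => /(congr1 (mcoeff U_(i)%MM)) /eqP.
by rewrite mcoeff0 mcoeffX eqxx oner_eq0.
Qed.

(** Modulo the ideal, every polynomial is congruent to its restriction rewritten in the x variables.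
    This holds for constants and variables and passes to sums and products. *)
Lemma restr_ker c h :
  restr c h = 0 -> ideal_gen (range (fun i => line i (c i))) h.
Proof.
set P := ideal_gen _; move=> h0.
have idP : is_ideal P by exact: ideal_gen_is_ideal.
have P0 : P 0 by case: idP.
pose xs : d.-tuple {mpoly K[d + d]} := [tuple xvar K i | i < d].
suff cong h1 : P (h1 - (restr c h1 \mPo xs)).
  by have := cong h; rewrite h0 comp_mpoly0 subr0.
have congM u v : P (u - (restr c u \mPo xs)) -> P (v - (restr c v \mPo xs)) ->
    P (u * v - (restr c (u * v) \mPo xs)).
  by rewrite !rmorphM; apply: ideal_subM.
have congC a : P (a%:MP - (restr c a%:MP \mPo xs)).
  by rewrite restrC comp_mpolyC subrr.
have congX v : P ('X_v - (restr c 'X_v \mPo xs)).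
  rewrite /restr /= taylorX /taylor_var -[v]splitK.
  case: (fintype.split v) => i; rewrite ?(unsplitK (inl i)) ?(unsplitK (inr i)) /=.
    by rewrite mcoeffC eqxx mulr1 comp_mpolyXU -tnth_nth tnth_mktuple subrr.
  (* For a variable y_i, the difference is the generator [line i (c i)] itself. *)
  rewrite mcoeffD mcoeffC eqxx mulr1 mcoeffX mnm1_eq0 add0r comp_mpolyZ.
  rewrite comp_mpolyXU -tnth_nth tnth_mktuple.
  by apply: mem_ideal_gen; exists i.
rewrite [h1]mpolyE !rmorph_sum -sumrB; apply: ideal_sum => // m _.
rewrite -mul_mpolyC; apply: (congM); first exact: congC.
rewrite mpolyXE_id.
apply: (big_ind (fun h1 => P (h1 - (restr c h1 \mPo xs)))) => [|x y|i _].
- by have := congC 1; rewrite mpolyC1.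
- exact: (congM x y).
- elim: (m i) => [|n IHn]; first by have := congC 1; rewrite mpolyC1.
  by rewrite exprS; apply: (congM _ _ (congX i) IHn).
Qed.

Definition lines r (i : 'I_d) := \prod_(b <- r i) line i b.

Lemma restr_lines_eq0 c r i : (restr c (lines r i) == 0) = (c i \in r i).
Proof.
rewrite rmorph_prod prodf_seq_eq0 -has_pred1; apply: eq_has => b /=.
exact: restr_line_eq0.
Qed.

Lemma restr_ideal c r h : (forall i, c i \in r i) ->
  ideal_gen (range (lines r)) h -> restr c h = 0.
Proof.
move=> cr /ideal_gen_rangeP[q ->]; rewrite rmorph_sum big1 // => i _.
have /eqP ri0 : restr c (lines r i) == 0 by rewrite restr_lines_eq0.
by rewrite rmorphM /= ri0 mulr0.
Qed.

Lemma restr_kerP c h :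
  ideal_gen (range (fun i => line i (c i))) h <-> restr c h = 0.
Proof.
split=> [|/restr_ker //].
have -> : (fun i => line i (c i)) = lines (fun i => [:: c i]).
  by apply/funext => i; rewrite /lines big_seq1.
by apply: restr_ideal => i; rewrite mem_head.
Qed.

(** Induction on the total number of scalars. One scalar [b0] is split off some [r i]: [h] is first
    expressed through the grid with [r i] reduced to [b0], and the coefficient of [line i b0] then
    vanishes on the remaining grid. *)
Lemma grid_ideal r h : (forall i, uniq (r i)) ->
  (forall c, (forall i, c i \in r i) -> restr c h = 0) ->
  ideal_gen (range (lines r)) h.
Proof.
have [n] := ubnP (\sum_i size (r i))%N; elim: n r h => // n IHn r h ltn Ur hr.
have [_ _ idM] := ideal_gen_is_ideal (range (lines r)).
have gen i : ideal_gen (range (lines r)) (lines r i).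
  by apply: mem_ideal_gen; exists i.
have [/existsP[i /eqP ri0]|/existsPn r_gt0] := boolP [exists i, r i == [::]].
  (* An empty list makes the generator 1 and the ideal the whole ring. *)
  have lri : lines r i = 1 by rewrite /lines ri0 big_nil.
  by rewrite -[h]mulr1 -lri; apply/idM/gen.
have [/existsP[i lt1]|/existsPn r_le1] := boolP [exists i, 1 < size (r i)]%N;
  last first.
  (* All lists are singletons here, so the grid is a single subspace; the default 0 is never
     reached. *)
  pose c i := head 0 (r i).
  have def_r i : r i = [:: c i].
    by have := r_gt0 i; have := r_le1 i; rewrite /c; case: (r i) => [|b []].
  have -> : lines r = fun i => line i (c i).
    by apply/funext => i; rewrite /lines def_r big_seq1.
  by apply: restr_ker; apply: hr => i; rewrite def_r mem_head.
case def_ri: (r i) lt1 => [|b0 [|b1 s]] // _.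
(* [upd t] replaces the list at [i] by [t]. Both [[:: b0]] and [b1 :: s] are shorter than [r i], so
   induction applies to each. *)
pose upd t j := if j == i then t else r j.
have size_upd t : (\sum_j size (upd t j) = size t + \sum_(j | j != i) size (r j))%N.
  rewrite (bigD1 i) //= /upd eqxx; congr (_ + _)%N.
  by apply: eq_bigr => j /negPf->.
have lt_upd t : (size t < size (r i))%N -> (\sum_j size (upd t j) < n)%N.
  move=> lt_t; rewrite -ltnS; apply: leq_trans ltn.
  by rewrite size_upd ltnS [X in (_ < X)%N](bigD1 i) //= ltn_add2r.
have uniq_upd t : uniq t -> forall j, uniq (upd t j).
  by move=> Ut j; rewrite /upd; case: ifP.
have lines_upd t j : j != i -> lines (upd t) j = lines r j.
  by rewrite /lines /upd => /negPf->.
have lines_updi t : lines (upd t) i = \prod_(b <- t) line i b.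
  by rewrite /lines /upd eqxx.
have Uri := Ur i; rewrite def_ri in lt_upd; rewrite def_ri /= in Uri.
have [b0_s Us] : b0 \notin b1 :: s /\ uniq (b1 :: s) by apply/andP.
have /ideal_gen_rangeP[q] : ideal_gen (range (lines (upd [:: b0]))) h.
  apply: IHn => [||c cu]; [exact: lt_upd | exact: uniq_upd | ].
  apply: hr => j; have := cu j; rewrite /upd; case: eqP => // ->.
  by rewrite def_ri !inE => ->.
rewrite (bigD1 i) //= lines_updi big_seq1; set t := \sum_(_ | _) _ => def_h.
have gen_rest (p : 'I_d -> _) u :
    ideal_gen (range (lines r)) (\sum_(j | j != i) p j * lines (upd u) j).
  apply: ideal_sum; first exact: ideal_gen_is_ideal.
  by move=> j ji; rewrite lines_upd //; apply: idM.
have /ideal_gen_rangeP[p] : ideal_gen (range (lines (upd (b1 :: s)))) (q i).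
  apply: IHn => [||c cu]; [exact: lt_upd | exact: uniq_upd | ].
  have cr j : c j \in r j.
    have := cu j; rewrite /upd; case: eqP => // ->.
    by rewrite def_ri => ci; rewrite inE ci orbT.
  (* On such a subspace the terms with [j != i] vanish, so [q i * line i b0] restricts to zero; as
     [b0] is not in [b1 :: s], the factor [line i b0] does not, hence [q i] does. *)
  have := hr c cr; rewrite def_h rmorphD rmorphM /=.
  rewrite (restr_ideal cr (gen_rest _ _)) addr0 => /eqP.
  rewrite mulf_eq0 [X in _ || X]restr_line_eq0 => /orP[/eqP //|/eqP b0c].
  by case/negP: b0_s; have := cu i; rewrite /upd eqxx b0c.
rewrite (bigD1 i) //= lines_updi => def_q.
have [_ idD _] := ideal_gen_is_ideal (range (lines r)).
rewrite def_h; apply: (idD); last exact: gen_rest.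
(* The term of index [i] in [q i] recombines with [line i b0] into [lines r i]; the others are
   multiples of the unchanged generators. *)
rewrite def_q mulrDl; apply: (idD); last by rewrite mulrC; apply/idM/gen_rest.
have lri : lines r i = (\prod_(b <- b1 :: s) line i b) * line i b0.
  by rewrite /lines def_ri big_cons mulrC.
by rewrite -mulrA -lri; apply/idM/gen.
Qed.

End Points.

(** * Associated primes and symbolic powers of the ideal of a grid *)

Section Grid.
Variables (K : fieldType) (d : nat) (r : 'I_d -> seq K).
Hypothesis Ur : forall i, uniq (r i).
Implicit Types (c : 'I_d -> K) (h : {mpoly K[d + d]}).

Let I : set {mpoly K[d + d]} := ideal_gen (range (lines r)).

(** When [c i] lies in [r i], this is [lines r i] divided by [line i (c i)]; distinctness of the
    scalars keeps it nonzero on y = c x. *)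
Definition cofactor c (i : 'I_d) := \prod_(b <- rem (c i) (r i)) line i b.

Lemma lines_cofactor c i : c i \in r i ->
  lines r i = cofactor c i * line i (c i).
Proof.
by move=> ci; rewrite /lines (perm_big _ (perm_to_rem ci)) big_cons mulrC.
Qed.

Lemma restr_cofactor_neq0 c i : restr c (cofactor c i) != 0.
Proof.
rewrite rmorph_prod prodf_seq_neq0; apply/allP => b /=.
by rewrite mem_rem_uniq // inE restr_line_eq0 => /andP[].
Qed.

Lemma restr_cofactor0 c c1 i : c1 i \in r i -> c1 i != c i ->
  restr c1 (cofactor c i) = 0.
Proof.
move=> c1i neq; apply/eqP; rewrite rmorph_prod prodf_seq_eq0.
apply/hasP; exists (c1 i); last by rewrite /= restr_line_eq0.
by rewrite mem_rem_uniq // inE /= neq.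
Qed.

Lemma grid_idealP h :
  I h <-> forall c, (forall i, c i \in r i) -> restr c h = 0.
Proof.
by split=> [Ih c cr|]; [exact: restr_ideal Ih | exact: grid_ideal].
Qed.

(** The prime of the component y = c x is the annihilator, modulo [I], of the product of all
    cofactors: that product vanishes on every other component of the grid but not on this one. *)
Lemma grid_associated_prime c : (forall i, c i \in r i) ->
  associated_prime I [set h | restr c h = 0].
Proof.
move=> cr; split.
  split=> [|/=|x y /=]; last 2 first.
  - by rewrite rmorph1 => /eqP; rewrite oner_eq0.
  - by rewrite rmorphM => /eqP; rewrite mulf_eq0 => /orP[]/eqP; [left|right].
  split=> /= [|x y|a x] ; first by rewrite rmorph0.
  - by rewrite rmorphD /= => -> ->; rewrite addr0.
  - by rewrite rmorphM /= => ->; rewrite mulr0.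
exists (\prod_i cofactor c i); apply/seteqP; split=> s /=.
  move=> s0; apply/grid_idealP => c1 c1r; rewrite rmorphM rmorph_prod /=.
  have [/existsP[i neq]|/existsPn eqc] := boolP [exists i, c1 i != c i].
    by rewrite (bigD1 i) //= restr_cofactor0 // mul0r mulr0.
  have -> : c1 = c by apply/funext => i; apply/eqP/negbNE/eqc.
  by rewrite s0 mul0r.
move/grid_idealP => /(_ c cr); rewrite rmorphM rmorph_prod /= => /eqP.
rewrite mulf_eq0 => /orP[/eqP //|]; rewrite prodf_seq_eq0 => /hasP[i _ /=].
by rewrite (negPf (restr_cofactor_neq0 c i)).
Qed.

Lemma symbolic_power_grid n : symbolic_power I n = ideal_pow I n.
Proof.
pose T := {c : 'I_d -> K | forall i, c i \in r i}.
apply: (@symbolic_power_quasi_regular _ d (lines r) T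
  (fun t => [set h | restr (sval t) h = 0]%classic)).
- by [].
- by case=> c cr; apply: grid_associated_prime.
- by move=> h hT; apply/grid_idealP => c cr; apply: (hT (exist _ c cr)).
move=> [c cr] m q s hq /= /eqP s0 Iq k.
(* Being outside the prime of [c] means exactly that the expansion of [s] has nonzero constant term,
   which is [s0]. *)
apply: (@mcoeff_form {mpoly K[d]} d _ (taylor c) (lines r)
  (fun i => taylor c (cofactor c i)) m q s k _ _ hq s0) => [i|i|].
- have eqX : taylor c (line i (c i)) = 'X_i.
    by rewrite taylor_line subrr scale0r mpolyC0 addr0.
  by rewrite (lines_cofactor (cr i)) rmorphM -eqX.
- exact: restr_cofactor_neq0.
- apply: (@order_ge_pow _ _ _ (taylor c) _ _ _ _ Iq) => y Iy.
  exact: restr_ideal Iy.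
Qed.

End Grid.

(** * The Derksen ideal of a diagonal action *)

Section DiagonalAction.
Variables (K : fieldType) (d : nat) (G : finGroupType).
Variable act : G -> {rmorphism {mpoly K[d]} -> {mpoly K[d]}}.
Hypothesis hact : linear_action act.

(** Reading the scalar off as a coefficient defines it for any action; [diag] then makes it an
    eigenvalue. *)
Definition weight (x : G) (j : 'I_d) : K := (act x 'X_j)@_U_(j)%MM.

Hypothesis diag : forall x j, act x 'X_j = weight x j *: 'X_j.

Lemma weight1 j : weight 1%g j = 1.
Proof. by rewrite /weight (linear_action1 hact) mcoeffXU eqxx. Qed.

Lemma weightM x y j : weight (x * y)%g j = weight x j * weight y j.
Proof.
rewrite {1}/weight (linear_actionM hact) [act y _]diag -mul_mpolyC rmorphM /=.
by rewrite (linear_actionC hact) mcoeffCM mulrC.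
Qed.

(** Different group elements may share a scalar; removing repetitions makes the factors in each
    [lines weights j] distinct. *)
Definition weights (j : 'I_d) : seq K := undup [seq weight x j | x : G].

Lemma mem_weights x j : weight x j \in weights j.
Proof. by rewrite mem_undup; apply: map_f; rewrite mem_enum. Qed.

Lemma derksen_idealP h :
  derksen_ideal act h <-> forall x, restr (weight x) h = 0.
Proof.
have eq_lines x : (fun i => yvar K i - in_xvars (act x 'X_i)) =
    fun i => line i (weight x i).
  apply/funext => i; rewrite diag /in_xvars comp_mpolyZ comp_mpolyXU.
  by rewrite -tnth_nth tnth_mktuple.
by split=> hI x => [|_]; have := hI x; rewrite ?eq_lines;
  [move=> /(_ I) /restr_kerP | move/restr_kerP].
Qed.

(** The action of [x] on one variable can be isolated by another group element; this makes the
    subspaces of the group elements fill a whole grid. *)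
Hypothesis split_weight : forall x j, exists y, weight y j = weight x j /\
  forall k, k != j -> weight y k = 1.

(** For each [j] an element acts by [c j] on the [j]-th variable and trivially on the others; their
    product acts by [c]. *)
Lemma weight_grid c :
  (forall j, c j \in weights j) -> exists x, weight x =1 c.
Proof.
move=> cw.
have /choice[y yP] j : exists y, weight y j = c j /\
    forall k, k != j -> weight y k = 1.
  have := cw j; rewrite mem_undup => /mapP[x _ ->]; exact: split_weight.
exists (\prod_j y j)%g => k.
rewrite (big_morph (weight^~ k) (fun x z => weightM x z k) (weight1 k)).
rewrite (bigD1 k) //= (yP k).1 big1 ?mulr1 // => j neq_jk.
by rewrite (yP j).2 // eq_sym.
Qed.

Lemma derksen_ideal_lines : derksen_ideal act = ideal_gen (range (lines weights)).
Proof.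
have Uw j : uniq (weights j) by exact: undup_uniq.
apply/seteqP; split=> h.
  move/derksen_idealP => h0; apply/grid_idealP => // c /weight_grid[x xc].
  have <- : weight x = c by apply/funext.
  exact: h0.
move=> hI; apply/derksen_idealP => x; move/grid_idealP: hI; apply=> // j.
exact: mem_weights.
Qed.

End DiagonalAction.

(** * The group generated by the [g i] *)

Theorem theorem4 (K : fieldType) (d a : nat) (ha : (a <= d)%N)
  (G : finGroupType)
  (act : G -> {rmorphism {mpoly K[d]} -> {mpoly K[d]}})
  (hact : linear_action act)
  (g : 'I_a -> G) (hG : (<<[set g i | i : 'I_a]%SET>>)%g = [set: G]%SET)
  (e : 'I_a -> nat) (he : forall i, (1 <= e i)%N)
  (w : 'I_a -> K) (hw : forall i, w i ^+ e i = 1)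
  (hg : forall (i : 'I_a) (j : 'I_d),
     act (g i) 'X_j = if j == i :> nat then w i *: 'X_j else 'X_j)
  (n : nat) (hn : (1 <= n)%N) :
  symbolic_power (derksen_ideal act) n = ideal_pow (derksen_ideal act) n.
Proof.
(* In a finite group every element is a product of generators without inverses, so closure under
   products suffices. *)
have ind (P : G -> Prop) : P 1%g -> (forall x y, P x -> P y -> P (x * y)%g) ->
    (forall i, P (g i)) -> forall x, P x.
  move=> P1 PM Pg x; have : x \in <<[set g i | i : 'I_a]%SET>>%g.
    by rewrite hG finset.in_setT.
  case/gen_prodgP => m [c cg ->]; apply: big_ind => // i _.
  by have /imsetP[j _ ->] := cg i.
have diag x j : act x 'X_j = weight act x j *: 'X_j.
  move: x j; apply: ind => [j|x y Dx Dy j|i j].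
  - by rewrite weight1 // (linear_action1 hact) scale1r.
  - rewrite /weight (linear_actionM hact) [act y _]Dy -mul_mpolyC rmorphM /=.
    rewrite (linear_actionC hact) Dx mcoeffCM mcoeffZ mcoeffXU eqxx mulr1.
    by rewrite mul_mpolyC scalerA.
  - rewrite /weight hg; case: ifP => _; last by rewrite mcoeffXU eqxx scale1r.
    by rewrite mcoeffZ mcoeffXU eqxx mulr1.
have split_weight x j : exists y, weight act y j = weight act x j /\
    forall k, k != j -> weight act y k = 1.
  move: x; apply: ind => [|x1 x2 [y1 [e1 t1]] [y2 [e2 t2]]|i].
  - by exists 1%g; split=> // k _; rewrite weight1.
  - exists (y1 * y2)%g; rewrite !weightM // e1 e2; split=> // k kj.
    by rewrite weightM // t1 // t2 // mulr1.
  (* If [j] is the index of the generator, [g i] itself fixes all other variables; otherwise [g i]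
     has weight 1 at [j] and the identity serves. *)
  - have [eq_ji|neq_ji] := eqVneq (j : nat) i.
      exists (g i); split=> // k; rewrite -val_eqE /= eq_ji => /negPf ki.
      by rewrite /weight hg ki mcoeffXU eqxx.
    exists 1%g; rewrite weight1 // /weight hg (negPf neq_ji) mcoeffXU eqxx.
    by split=> // k _; rewrite -/(weight _ _ _) weight1.
rewrite (derksen_ideal_lines hact diag split_weight).
by apply: symbolic_power_grid => j; apply: undup_uniq.
Qed.
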